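(* Consider the category $\mathcal{P}(\mathbb{Z}/4)$ of finitely generated projective $\mathbb{Z}/4$-modules with its triangulated category structure with identity translation functor. Then $$\mathbb{Z}/4\xrightarrow{2}\mathbb{Z}/4\xrightarrow{2}\mathbb{Z}/4\xrightarrow{2}\mathbb{Z}/4$$ is an exact triangle in $\mathcal{P}(\mathbb{Z}/4)$, and the triangulated category $\mathcal{P}(\mathbb{Z}/4)$ is not algebraic, i.e. it is not exact equivalent to the stable category of any Frobenius category.
   Context: A triangulated category is an additive category with a translation self-equivalence $\Sigma$ and a collection of exact triangles satisfying Puppe's axioms and Verdier's octahedral axiom. The category $\mathcal{P}(\mathbb{Z}/4)$ has exactly one triangulated category structure with translation functor $\Sigma=\mathrm{id}$, and this is the structure meant in the claim. An exact functor between triangulated categories is an additive functor which commutes with the translation functors up to natural isomorphism and preserves exact triangles; an exact equivalence is an exact functor that is an equivalence of categories. A Frobenius category is an exact category with enough projectives and enough injectives in which projectives and injectives coincide; its stable category (the quotient by the ideal of morphisms factoring through an injective object) is triangulated in the usual way, with $\Sigma X$ the cokernel of an admissible monomorphism from $X$ into an injective object. *)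

(* Defs.v *)
From HB Require Import structures.
From mathcomp Require Import all_boot all_order all_algebra.
From mathcomp Require Import boolp.

Set Implicit Arguments.
Unset Strict Implicit.
Unset Printing Implicit Defensive.

Import GRing.Theory.
Local Open Scope ring_scope.
Local Open Scope quotient_scope.

Reserved Notation "g ∘ f" (at level 40, left associativity).

Record additive_category := AdditiveCategory {
  obj :> Type;
  hom : obj -> obj -> zmodType;
  idm : forall X, hom X X;
  comp : forall X Y Z, hom Y Z -> hom X Y -> hom X Z;
  _ : forall X Y Z W (h : hom Z W) (g : hom Y Z) (f : hom X Y),
      comp h (comp g f) = comp (comp h g) f;
  _ : forall X Y (f : hom X Y), comp (idm Y) f = f;
  _ : forall X Y (f : hom X Y), comp f (idm X) = f;
  _ : forall X Y Z (g g' : hom Y Z) (f : hom X Y),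
      comp (g + g') f = comp g f + comp g' f;
  _ : forall X Y Z (g : hom Y Z) (f f' : hom X Y),
      comp g (f + f') = comp g f + comp g f';
  _ : exists O : obj, forall X,
      (forall f : hom O X, f = 0) /\ (forall f : hom X O, f = 0);
  _ : forall X Y, exists B : obj,
      exists (i1 : hom X B) (i2 : hom Y B) (p1 : hom B X) (p2 : hom B Y),
      [/\ comp p1 i1 = idm X, comp p2 i2 = idm Y, comp p2 i1 = 0,
          comp p1 i2 = 0 & comp i1 p1 + comp i2 p2 = idm B]
}.

Arguments hom {a} X Y.
Arguments idm {a} X.
Arguments comp {a X Y Z} g f.

Notation "g ∘ f" := (comp g f).

Section AdditiveTheory.
Variable C : additive_category.

Lemma compA (X Y Z W : C) (h : hom Z W) (g : hom Y Z) (f : hom X Y) :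
  h ∘ (g ∘ f) = h ∘ g ∘ f.
Proof. by case: C X Y Z W h g f. Qed.

Lemma comp1m (X Y : C) (f : hom X Y) : idm Y ∘ f = f.
Proof. by case: C X Y f. Qed.

Lemma compm1 (X Y : C) (f : hom X Y) : f ∘ idm X = f.
Proof. by case: C X Y f. Qed.

Lemma compDl (X Y Z : C) (g g' : hom Y Z) (f : hom X Y) :
  (g + g') ∘ f = g ∘ f + g' ∘ f.
Proof. by case: C X Y Z g g' f. Qed.

Lemma compDr (X Y Z : C) (g : hom Y Z) (f f' : hom X Y) :
  g ∘ (f + f') = g ∘ f + g ∘ f'.
Proof. by case: C X Y Z g f f'. Qed.

Lemma zero_objP : exists O : C, forall X : C,
  (forall f : hom O X, f = 0) /\ (forall f : hom X O, f = 0).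
Proof. by case: C. Qed.

Lemma biproductP (X Y : C) : exists B : C,
  exists (i1 : hom X B) (i2 : hom Y B) (p1 : hom B X) (p2 : hom B Y),
    [/\ p1 ∘ i1 = idm X, p2 ∘ i2 = idm Y, p2 ∘ i1 = 0, p1 ∘ i2 = 0
      & i1 ∘ p1 + i2 ∘ p2 = idm B].
Proof. by case: C X Y. Qed.

Lemma comp0m (X Y Z : C) (f : hom X Y) : (0 : hom Y Z) ∘ f = 0.
Proof. by apply: (addrI ((0 : hom Y Z) ∘ f)); rewrite -compDl !addr0. Qed.

Lemma compm0 (X Y Z : C) (g : hom Y Z) : g ∘ (0 : hom X Y) = 0.
Proof. by apply: (addrI (g ∘ (0 : hom X Y))); rewrite -compDr !addr0. Qed.

Lemma compNl (X Y Z : C) (g : hom Y Z) (f : hom X Y) : (- g) ∘ f = - (g ∘ f).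
Proof. by apply: (addrI (g ∘ f)); rewrite -compDl !subrr comp0m. Qed.

Lemma compNr (X Y Z : C) (g : hom Y Z) (f : hom X Y) : g ∘ (- f) = - (g ∘ f).
Proof. by apply: (addrI (g ∘ f)); rewrite -compDr !subrr compm0. Qed.

Lemma compBl (X Y Z : C) (g g' : hom Y Z) (f : hom X Y) :
  (g - g') ∘ f = g ∘ f - g' ∘ f.
Proof. by rewrite compDl compNl. Qed.

Lemma compBr (X Y Z : C) (g : hom Y Z) (f f' : hom X Y) :
  g ∘ (f - f') = g ∘ f - g ∘ f'.
Proof. by rewrite compDr compNr. Qed.

Definition inverse_pair (X Y : C) (f : hom X Y) (g : hom Y X) :=
  g ∘ f = idm X /\ f ∘ g = idm Y.

Definition is_iso (X Y : C) (f : hom X Y) := exists g, inverse_pair f g.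

Definition is_kernel (X Y Z : C) (i : hom X Y) (p : hom Y Z) :=
  p ∘ i = 0 /\
  forall W (f : hom W Y), p ∘ f = 0 -> exists! g : hom W X, i ∘ g = f.

Definition is_cokernel (X Y Z : C) (i : hom X Y) (p : hom Y Z) :=
  p ∘ i = 0 /\
  forall W (f : hom Y W), f ∘ i = 0 -> exists! g : hom Z W, g ∘ p = f.

(* The square   X --f--> Y
                |g       |g'
                Z --f'-> W   *)
Definition is_pushout (X Y Z W : C) (f : hom X Y) (g : hom X Z)
    (g' : hom Y W) (f' : hom Z W) :=
  g' ∘ f = f' ∘ g /\
  forall V (a : hom Y V) (b : hom Z V), a ∘ f = b ∘ g ->
    exists! c : hom W V, c ∘ g' = a /\ c ∘ f' = b.

Definition is_pullback (X Y Z W : C) (f : hom X Y) (g : hom X Z)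
    (g' : hom Y W) (f' : hom Z W) :=
  g' ∘ f = f' ∘ g /\
  forall V (a : hom V Y) (b : hom V Z), g' ∘ a = f' ∘ b ->
    exists! c : hom V X, f ∘ c = a /\ g ∘ c = b.

End AdditiveTheory.

Record functor (C D : additive_category) := Functor {
  fobj :> C -> D;
  fmap : forall X Y : C, hom X Y -> hom (fobj X) (fobj Y);
  fmap1 : forall X, fmap (idm X) = idm (fobj X);
  fmap_comp : forall (X Y Z : C) (g : hom Y Z) (f : hom X Y),
      fmap (g ∘ f) = fmap g ∘ fmap f
}.

Arguments fmap {C D} F {X Y} f : rename.

Definition id_functor (C : additive_category) : functor C C :=
  @Functor C C (fun X => X) (fun _ _ f => f)
    (fun _ => erefl) (fun _ _ _ _ _ => erefl).

Section CompFunctor.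
Variables (C D E : additive_category) (G : functor D E) (F : functor C D).

Let comp_map (X Y : C) (f : hom X Y) := fmap G (fmap F f).

Fact comp_map1 X : comp_map (idm X) = idm (G (F X)).
Proof. by rewrite /comp_map !fmap1. Qed.

Fact comp_map_comp (X Y Z : C) (g : hom Y Z) (f : hom X Y) :
  comp_map (g ∘ f) = comp_map g ∘ comp_map f.
Proof. by rewrite /comp_map !fmap_comp. Qed.

Definition comp_functor : functor C E := Functor comp_map1 comp_map_comp.
End CompFunctor.

Definition additive_functor (C D : additive_category) (F : functor C D) :=
  forall (X Y : C) (f g : hom X Y), fmap F (f + g) = fmap F f + fmap F g.

Definition natural_iso (C D : additive_category) (F G : functor C D)
    (t : forall X : C, hom (F X) (G X)) :=
  (forall X, is_iso (t X)) /\
  forall (X Y : C) (f : hom X Y), t Y ∘ fmap F f = fmap G f ∘ t X.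

Definition naturally_isomorphic (C D : additive_category) (F G : functor C D) :=
  exists t : forall X : C, hom (F X) (G X), natural_iso t.

Definition equivalence (C D : additive_category) (F : functor C D) :=
  exists G : functor D C,
    naturally_isomorphic (comp_functor G F) (id_functor C) /\
    naturally_isomorphic (comp_functor F G) (id_functor D).

Definition triangle_class (C : additive_category) (S : functor C C) :=
  forall X Y Z : C, hom X Y -> hom Y Z -> hom Z (S X) -> Prop.

(* The data underlying a triangulated category.  [exact_tri f g h] says that
   X -f-> Y -g-> Z -h-> shift X is one of the distinguished triangles. *)
Record pretriangulated := Pretriangulated {
  tcat :> additive_category;
  shift : functor tcat tcat;
  exact_tri : triangle_class shift
}.

Arguments shift : clear implicits.
Arguments exact_tri T {X Y Z} f g h : rename.

Record triangulated (T : pretriangulated) : Prop := Triangulated {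
  shift_additive : additive_functor (shift T);
  shift_equivalence : equivalence (shift T);
  exact_tri_iso : forall (X Y Z X' Y' Z' : T)
      (f : hom X Y) (g : hom Y Z) (h : hom Z (shift T X))
      (f' : hom X' Y') (g' : hom Y' Z') (h' : hom Z' (shift T X'))
      (a : hom X X') (b : hom Y Y') (c : hom Z Z'),
      exact_tri T f g h -> is_iso a -> is_iso b -> is_iso c ->
      b ∘ f = f' ∘ a -> c ∘ g = g' ∘ b -> fmap (shift T) a ∘ h = h' ∘ c ->
      exact_tri T f' g' h';
  exact_tri_id : forall X O : T, idm O = 0 ->
      exact_tri T (idm X) (0 : hom X O) 0;
  exact_tri_cone : forall (X Y : T) (f : hom X Y),
      exists (Z : T) (g : hom Y Z) (h : hom Z (shift T X)), exact_tri T f g h;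
  exact_tri_rot : forall (X Y Z : T)
      (f : hom X Y) (g : hom Y Z) (h : hom Z (shift T X)),
      exact_tri T f g h <-> exact_tri T g h (- fmap (shift T) f);
  exact_tri_fill : forall (X Y Z X' Y' Z' : T)
      (f : hom X Y) (g : hom Y Z) (h : hom Z (shift T X))
      (f' : hom X' Y') (g' : hom Y' Z') (h' : hom Z' (shift T X'))
      (a : hom X X') (b : hom Y Y'),
      exact_tri T f g h -> exact_tri T f' g' h' -> b ∘ f = f' ∘ a ->
      exists c : hom Z Z',
        c ∘ g = g' ∘ b /\ fmap (shift T) a ∘ h = h' ∘ c;
  octahedron : forall (X Y Z U V W : T) (f : hom X Y) (g : hom Y Z)
      (a : hom Y U) (b : hom U (shift T X))
      (c : hom Z V) (d : hom V (shift T Y))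
      (e : hom Z W) (h : hom W (shift T X)),
      exact_tri T f a b -> exact_tri T g c d -> exact_tri T (g ∘ f) e h ->
      exists (u : hom U W) (v : hom W V),
        [/\ exact_tri T u v (fmap (shift T) a ∘ d),
            u ∘ a = e ∘ g, h ∘ u = b, v ∘ e = c
          & d ∘ v = fmap (shift T) f ∘ h]
}.

Definition exact_functor (S T : pretriangulated) (F : functor S T) :=
  additive_functor F /\
  exists t : forall X : S, hom (F (shift S X)) (shift T (F X)),
    @natural_iso _ _ (comp_functor F (shift S)) (comp_functor (shift T) F) t /\
    forall (X Y Z : S) (f : hom X Y) (g : hom Y Z) (h : hom Z (shift S X)),
      exact_tri S f g h ->
      exact_tri T (fmap F f) (fmap F g) (t X ∘ fmap F h).

Definition exact_equivalent (S T : pretriangulated) :=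
  exists F : functor S T, exact_functor F /\ equivalence F.

Section Admissible.
Variables (C : additive_category).
Variable confl : forall X Y Z : C, hom X Y -> hom Y Z -> Prop.

Definition admissible_mono (X Y : C) (i : hom X Y) :=
  exists (Z : C) (p : hom Y Z), confl i p.

Definition admissible_epi (Y Z : C) (p : hom Y Z) :=
  exists (X : C) (i : hom X Y), confl i p.
End Admissible.

(* Quillen exact categories: an additive category with a class of short exact
   sequences [conflation i p], i the admissible monomorphism, p the admissible
   epimorphism. *)
Record exact_category := ExactCategory {
  ecat :> additive_category;
  conflation : forall X Y Z : ecat, hom X Y -> hom Y Z -> Prop;
  conflation_kercoker : forall (X Y Z : ecat) (i : hom X Y) (p : hom Y Z),
      conflation i p -> is_kernel i p /\ is_cokernel i p;
  conflation_iso : forall (X Y Z X' Y' Z' : ecat)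
      (i : hom X Y) (p : hom Y Z) (i' : hom X' Y') (p' : hom Y' Z')
      (a : hom X X') (b : hom Y Y') (c : hom Z Z'),
      conflation i p -> is_iso a -> is_iso b -> is_iso c ->
      b ∘ i = i' ∘ a -> c ∘ p = p' ∘ b -> conflation i' p';
  admissible_mono_id : forall X : ecat, admissible_mono conflation (idm X);
  admissible_epi_id : forall X : ecat, admissible_epi conflation (idm X);
  admissible_mono_comp : forall (X Y Z : ecat) (i : hom X Y) (j : hom Y Z),
      admissible_mono conflation i -> admissible_mono conflation j ->
      admissible_mono conflation (j ∘ i);
  admissible_epi_comp : forall (X Y Z : ecat) (p : hom X Y) (q : hom Y Z),
      admissible_epi conflation p -> admissible_epi conflation q ->
      admissible_epi conflation (q ∘ p);
  admissible_mono_pushout : forall (X Y Z : ecat) (i : hom X Y) (f : hom X Z),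
      admissible_mono conflation i ->
      exists (W : ecat) (f' : hom Y W) (i' : hom Z W),
        is_pushout i f f' i' /\ admissible_mono conflation i';
  admissible_epi_pullback : forall (Y Z W : ecat) (p : hom Y W) (f : hom Z W),
      admissible_epi conflation p ->
      exists (X : ecat) (f' : hom X Y) (p' : hom X Z),
        is_pullback f' p' p f /\ admissible_epi conflation p'
}.

Definition injective_obj (E : exact_category) (I : E) :=
  forall (X Y : E) (i : hom X Y) (f : hom X I),
    admissible_mono (@conflation E) i -> exists g : hom Y I, g ∘ i = f.

Definition projective_obj (E : exact_category) (P : E) :=
  forall (Y Z : E) (p : hom Y Z) (f : hom P Z),
    admissible_epi (@conflation E) p -> exists g : hom P Y, p ∘ g = f.

Definition enough_injectives (E : exact_category) :=
  forall X : E, exists (I : E) (i : hom X I),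
    injective_obj I /\ admissible_mono (@conflation E) i.

Definition enough_projectives (E : exact_category) :=
  forall X : E, exists (P : E) (p : hom P X),
    projective_obj P /\ admissible_epi (@conflation E) p.

Definition frobenius (E : exact_category) :=
  [/\ enough_projectives E, enough_injectives E
    & forall X : E, projective_obj X <-> injective_obj X].

(* The choices on which the translation functor of the stable category
   depends: for each X a conflation X -> inj_of X -> susp X with inj_of X
   injective.  Such choices exist when E has enough injectives. *)
Record injective_embeddings (E : exact_category) := InjectiveEmbeddings {
  inj_of : E -> E;
  susp : E -> E;
  inj_in : forall X, hom X (inj_of X);
  inj_out : forall X, hom (inj_of X) (susp X);
  inj_of_injective : forall X, injective_obj (inj_of X);
  inj_confl : forall X, conflation (inj_in X) (inj_out X)
}.

Section StableHom.
Variable E : exact_category.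

Definition inj_factor (X Y : E) (f : hom X Y) :=
  exists (I : E) (a : hom X I) (b : hom I Y), injective_obj I /\ f = b ∘ a.

Definition inj_ideal (X Y : E) : {pred hom X Y} :=
  fun f => `[< inj_factor f >].

Lemma inj_factor_compr (X Y Z : E) (g : hom Y Z) (f : hom X Y) :
  inj_factor f -> inj_factor (g ∘ f).
Proof. by case=> I [a [b [hI ->]]]; exists I, a, (g ∘ b); rewrite compA. Qed.

Lemma inj_factor_compl (X Y Z : E) (g : hom Y Z) (f : hom X Y) :
  inj_factor g -> inj_factor (g ∘ f).
Proof. by case=> I [a [b [hI ->]]]; exists I, (a ∘ f), b; rewrite compA. Qed.

Fact inj_ideal_zmod (X Y : E) : zmod_closed (@inj_ideal X Y).
Proof.
split=> [|f f'].
  apply/asboolP; have [O hO] := zero_objP E.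
  exists O, 0, 0; split; last by rewrite comp0m.
  by move=> U V i f _; exists 0; rewrite comp0m (proj2 (hO U) f).
move=> /asboolP[I [a [b [hI ->]]]] /asboolP[J [c [d [hJ ->]]]]; apply/asboolP.
have [B [i1 [i2 [p1 [p2 [h11 h22 h21 h12 h]]]]]] := biproductP I J.
exists B, (i1 ∘ a + i2 ∘ c), (b ∘ p1 - d ∘ p2); split.
  move=> U V i u hi.
  have [g1 e1] := hI _ _ i (p1 ∘ u) hi; have [g2 e2] := hJ _ _ i (p2 ∘ u) hi.
  by exists (i1 ∘ g1 + i2 ∘ g2);
    rewrite compDl -!compA e1 e2 !compA -compDl h comp1m.
have hb : b ∘ p1 ∘ (i1 ∘ a + i2 ∘ c) = b ∘ a.
  by rewrite -compA compDr !(compA p1) h11 h12 comp1m comp0m addr0.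
have hd : d ∘ p2 ∘ (i1 ∘ a + i2 ∘ c) = d ∘ c.
  by rewrite -compA compDr !(compA p2) h21 h22 comp1m comp0m add0r.
by rewrite compBl hb hd.
Qed.

HB.instance Definition _ (X Y : E) :=
  GRing.isZmodClosed.Build (hom X Y) (@inj_ideal X Y) (inj_ideal_zmod X Y).

Definition stable_hom (X Y : E) : zmodType :=
  Quotient.quot (@inj_ideal X Y : zmodClosed (hom X Y)).

Definition stable_class (X Y : E) (f : hom X Y) : stable_hom X Y :=
  \pi_(Quotient.quot (@inj_ideal X Y : zmodClosed (hom X Y))) f.

Definition stable_repr (X Y : E) (f : stable_hom X Y) : hom X Y :=
  @repr _ (Quotient.quot (@inj_ideal X Y : zmodClosed (hom X Y))) f.

Lemma stable_reprK (X Y : E) (f : stable_hom X Y) :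
  stable_class (stable_repr f) = f.
Proof. exact: reprK. Qed.

Lemma stable_classP (X Y : E) (f g : hom X Y) :
  stable_class f = stable_class g <-> inj_factor (f - g).
Proof.
have h := @Quotient.idealrBE _ (@inj_ideal X Y : zmodClosed (hom X Y)) f g.
split=> [/eqP e | /asboolP e]; first by apply/asboolP; exact: etrans h e.
by apply/eqP; exact: etrans (esym h) e.
Qed.

Lemma stable_classD (X Y : E) (f g : hom X Y) :
  stable_class (f + g) = stable_class f + stable_class g.
Proof.
exact: (@pi_addr _ _ _ _ _
  (Quotient.quot (@inj_ideal X Y : zmodClosed (hom X Y))) f g). Qed.

Lemma stable_class0 (X Y : E) : stable_class (0 : hom X Y) = 0.
Proof. by apply: (addrI (stable_class 0)); rewrite -stable_classD !addr0. Qed.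

Definition stable_comp (X Y Z : E) (g : stable_hom Y Z) (f : stable_hom X Y) :
  stable_hom X Z := stable_class (stable_repr g ∘ stable_repr f).

Lemma stable_class_comp (X Y Z : E) (g : hom Y Z) (f : hom X Y) :
  stable_comp (stable_class g) (stable_class f) = stable_class (g ∘ f).
Proof.
apply/esym; rewrite /stable_comp.
set g' := stable_repr _; set f' := stable_repr _.
transitivity (stable_class (g' ∘ f)); apply/stable_classP.
  rewrite -compBl; apply/inj_factor_compl/stable_classP.
  by rewrite stable_reprK.
rewrite -compBr; apply/inj_factor_compr/stable_classP.
by rewrite stable_reprK.
Qed.

Fact stable_compA (X Y Z W : E) (h : stable_hom Z W) (g : stable_hom Y Z)
    (f : stable_hom X Y) :
  stable_comp h (stable_comp g f) = stable_comp (stable_comp h g) f.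
Proof.
by rewrite -[h]stable_reprK -[g]stable_reprK -[f]stable_reprK
  !stable_class_comp compA.
Qed.

Fact stable_comp1m (X Y : E) (f : stable_hom X Y) :
  stable_comp (stable_class (idm Y)) f = f.
Proof. by rewrite -[f]stable_reprK stable_class_comp comp1m. Qed.

Fact stable_compm1 (X Y : E) (f : stable_hom X Y) :
  stable_comp f (stable_class (idm X)) = f.
Proof. by rewrite -[f]stable_reprK stable_class_comp compm1. Qed.

Fact stable_compDl (X Y Z : E) (g g' : stable_hom Y Z) (f : stable_hom X Y) :
  stable_comp (g + g') f = stable_comp g f + stable_comp g' f.
Proof.
by rewrite -[g]stable_reprK -[g']stable_reprK -[f]stable_reprK
  -stable_classD !stable_class_comp compDl stable_classD.
Qed.

Fact stable_compDr (X Y Z : E) (g : stable_hom Y Z) (f f' : stable_hom X Y) :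
  stable_comp g (f + f') = stable_comp g f + stable_comp g f'.
Proof.
by rewrite -[g]stable_reprK -[f']stable_reprK -[f]stable_reprK
  -stable_classD !stable_class_comp compDr stable_classD.
Qed.

Fact stable_zero : exists O : E, forall X : E,
  (forall f : stable_hom O X, f = 0) /\ (forall f : stable_hom X O, f = 0).
Proof.
have [O hO] := zero_objP E; exists O => X; have [h1 h2] := hO X.
by split=> f; rewrite -[f]stable_reprK ?(h1 (stable_repr f))
  ?(h2 (stable_repr f)) stable_class0.
Qed.

Fact stable_biproduct (X Y : E) : exists B : E,
  exists (i1 : stable_hom X B) (i2 : stable_hom Y B)
    (p1 : stable_hom B X) (p2 : stable_hom B Y),
  [/\ stable_comp p1 i1 = stable_class (idm X),
      stable_comp p2 i2 = stable_class (idm Y),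
      stable_comp p2 i1 = 0, stable_comp p1 i2 = 0
    & stable_comp i1 p1 + stable_comp i2 p2 = stable_class (idm B)].
Proof.
have [B [i1 [i2 [p1 [p2 [h11 h22 h21 h12 h]]]]]] := biproductP X Y.
exists B, (stable_class i1), (stable_class i2), (stable_class p1),
  (stable_class p2).
by split; rewrite !stable_class_comp -?stable_classD ?h11 ?h22 ?h21 ?h12 ?h
  ?stable_class0.
Qed.

Definition stable_additive : additive_category :=
  AdditiveCategory stable_compA stable_comp1m stable_compm1 stable_compDl
    stable_compDr stable_zero stable_biproduct.

End StableHom.

Section StableTriangulation.
Variables (E : exact_category) (H : injective_embeddings E).

Local Notation iota := (inj_in H).
Local Notation quo := (inj_out H).

(* s : susp X -> susp Y is induced by f through some extension of f to the
   chosen injective objects; this determines the class of s. *)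
Definition susp_lift (X Y : E) (f : hom X Y) (s : hom (susp H X) (susp H Y)) :=
  exists e : hom (inj_of H X) (inj_of H Y),
    e ∘ iota X = iota Y ∘ f /\ s ∘ quo X = quo Y ∘ e.

Lemma inj_mono (X : E) : admissible_mono (@conflation E) (iota X).
Proof. by exists (susp H X), (quo X); apply: inj_confl. Qed.

Lemma quo_iota (X : E) : quo X ∘ iota X = 0.
Proof. by have [[->]] := conflation_kercoker (inj_confl H X). Qed.

Lemma quo_fact (X Y : E) (f : hom (inj_of H X) Y) :
  f ∘ iota X = 0 -> exists g : hom (susp H X) Y, g ∘ quo X = f.
Proof.
have [_ [_ h]] := conflation_kercoker (inj_confl H X).
by move=> /h[g [hg _]]; exists g.
Qed.

Lemma quo_epi (X Y : E) (f g : hom (susp H X) Y) :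
  f ∘ quo X = g ∘ quo X -> f = g.
Proof.
have [_ [_ h]] := conflation_kercoker (inj_confl H X) => e.
have [|k [_ hk]] := h _ (g ∘ quo X); first by rewrite -compA quo_iota compm0.
by rewrite -(hk f e) -(hk g erefl).
Qed.

Lemma susp_liftP (X Y : E) (f : hom X Y) : exists s, susp_lift f s.
Proof.
have [e he] := inj_of_injective (iota Y ∘ f) (inj_mono X).
have [|s hs] := @quo_fact X _ (quo Y ∘ e); last by exists s, e.
by rewrite -compA he compA quo_iota comp0m.
Qed.

Lemma susp_lift_stable (X Y : E) (f f' : hom X Y) s s' :
  susp_lift f s -> susp_lift f' s' -> inj_factor (f - f') ->
  stable_class s = stable_class s'.
Proof.
move=> [e [he hs]] [e' [he' hs']] [J [a [b [hJ hf]]]]; apply/stable_classP.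
have [a' ha'] := hJ _ _ _ a (inj_mono X).
have [|t ht] := @quo_fact X _ (e - e' - iota Y ∘ b ∘ a').
  by rewrite !compBl he he' -compBr hf -!compA ha' subrr.
exists (inj_of H Y), t, (quo Y); split; first exact: inj_of_injective.
apply: quo_epi; rewrite compBl hs hs' -compA ht !compBr !compA quo_iota.
by rewrite !comp0m subr0.
Qed.

Definition susp_map (X Y : E) (f : stable_hom X Y) :
    stable_hom (susp H X) (susp H Y) :=
  stable_class (projT1 (cid (susp_liftP (stable_repr f)))).

Lemma susp_mapE (X Y : E) (f : hom X Y) s :
  susp_lift f s -> susp_map (stable_class f) = stable_class s.
Proof.
rewrite /susp_map; case: cid => s' /= hs' hs; apply: susp_lift_stable hs' hs _.
by apply/stable_classP; rewrite stable_reprK.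
Qed.

Fact susp_map1 (X : stable_additive E) :
  susp_map (idm X) = idm (susp H X : stable_additive E).
Proof.
apply: susp_mapE; exists (idm _).
by rewrite !comp1m !compm1.
Qed.

Fact susp_map_comp (X Y Z : stable_additive E) (g : hom Y Z) (f : hom X Y) :
  susp_map (g ∘ f) =
    (susp_map g : hom (susp H Y : stable_additive E) (susp H Z)) ∘ susp_map f.
Proof.
have [s hs] := susp_liftP (stable_repr f).
have [t ht] := susp_liftP (stable_repr g).
rewrite -[f]stable_reprK -[g]stable_reprK (susp_mapE hs) (susp_mapE ht).
rewrite [LHS](_ : _ = susp_map (stable_class (stable_repr g ∘ stable_repr f)));
  last by rewrite -stable_class_comp.
rewrite [RHS]stable_class_comp; apply: susp_mapE.
case: hs => e [he hs]; case: ht => e' [he' ht]; exists (e' ∘ e).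
by rewrite -!compA he hs !compA he' ht.
Qed.

Definition stable_shift : functor (stable_additive E) (stable_additive E) :=
  @Functor (stable_additive E) (stable_additive E) (susp H) susp_map
    susp_map1 susp_map_comp.

(* The standard triangle of f : X -> Y is the image of X -f-> Y -j-> C -q->
   susp X, where C is the pushout of iota X along f:
     X --inj_in--> inj_of X --inj_out--> susp X
     |f              |k                 ||
     Y -----j----->  C  -------q----->  susp X  *)
Definition standard_tri (X Y C : E) (f : hom X Y) (j : hom Y C)
    (q : hom C (susp H X)) :=
  exists k : hom (inj_of H X) C,
    [/\ is_pushout (iota X) f k j, q ∘ j = 0 & q ∘ k = quo X].

Definition stable_tri : triangle_class stable_shift := fun X Y Z f g h =>
  exists (X' Y' C : E) (f' : @hom E X' Y') (j : @hom E Y' C)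
      (q : @hom E C (susp H X')),
    standard_tri f' j q /\
    exists (a : hom (X' : stable_additive E) X)
        (b : hom (Y' : stable_additive E) Y)
        (c : hom (C : stable_additive E) Z),
      [/\ is_iso a, is_iso b & is_iso c] /\
      [/\ b ∘ stable_class f' = f ∘ a, c ∘ stable_class j = g ∘ b
        & fmap stable_shift a ∘ stable_class q = h ∘ c].

Definition stable_category : pretriangulated :=
  @Pretriangulated (stable_additive E) stable_shift stable_tri.

End StableTriangulation.

(* No proof that [stable_category] is triangulated is needed to say that a
   functor into it is exact: exactness only involves the underlying data. *)
Definition algebraic (T : pretriangulated) :=
  exists (E : exact_category) (H : injective_embeddings E),
    frobenius E /\ exact_equivalent T (stable_category H).

Section LinearMaps.
Variables (R : nzRingType) (M N : lmodType R).

Definition linmap := {linear M -> N}.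

Lemma linmapP (f g : linmap) : (forall x, f x = g x) -> f = g.
Proof.
move=> fg; have {fg} : (f : M -> N) = g by apply/funext.
case: f g => [f [[f1] [fZ]]] [g [[g1] [gZ]]] /= fg; subst g.
by rewrite (Prop_irrelevance f1 g1) (Prop_irrelevance fZ gZ).
Qed.

HB.instance Definition _ := gen_eqMixin linmap.
HB.instance Definition _ := gen_choiceMixin linmap.

Let add (f g : linmap) : linmap := f \+ g.
Let opp (f : linmap) : linmap := \- f.
Let zero : linmap := \0.

Fact linmap_addA : associative add.
Proof. by move=> f g h; apply: linmapP => x /=; rewrite addrA. Qed.

Fact linmap_addC : commutative add.
Proof. by move=> f g; apply: linmapP => x /=; rewrite addrC. Qed.

Fact linmap_add0 : left_id zero add.
Proof. by move=> f; apply: linmapP => x /=; rewrite add0r. Qed.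

Fact linmap_addN : left_inverse zero opp add.
Proof. by move=> f; apply: linmapP => x /=; rewrite addNr. Qed.

HB.instance Definition _ := GRing.isZmodule.Build linmap
  linmap_addA linmap_addC linmap_add0 linmap_addN.
End LinearMaps.

Section DirectSum.
Variables (R : nzRingType) (M N : lmodType R).

Definition in_left (x : M) : (M * N)%type := (x, 0).
Definition in_right (y : N) : (M * N)%type := (0, y).

Fact in_left_linear : linear in_left.
Proof.
by move=> a x y; apply/eqP; rewrite xpair_eqE /= !scaler0 addr0 !eqxx.
Qed.

Fact in_right_linear : linear in_right.
Proof.
by move=> a x y; apply/eqP; rewrite xpair_eqE /= !scaler0 addr0 !eqxx.
Qed.

HB.instance Definition _ := GRing.isLinear.Build R M (M * N)%type _ in_left
  in_left_linear.
HB.instance Definition _ := GRing.isLinear.Build R N (M * N)%type _ in_right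
  in_right_linear.

Lemma in_leftD_right x y : in_left x + in_right y = (x, y).
Proof. by apply/eqP; rewrite xpair_eqE /= addr0 add0r !eqxx. Qed.
End DirectSum.

Section FinitelyGeneratedProjectives.
Variable R : nzRingType.

Definition finitely_generated (M : lmodType R) :=
  exists (n : nat) (e : 'I_n -> M),
    forall x, exists a : 'I_n -> R, x = \sum_(i < n) a i *: e i.

Definition projective_module (P : lmodType R) :=
  forall (M N : lmodType R) (p : {linear M -> N}) (f : {linear P -> N}),
    (forall y, exists x, p x = y) ->
    exists g : {linear P -> M}, forall x, p (g x) = f x.

Record fgproj := FGProj {
  fgmod :> lmodType R;
  fgmod_fg : finitely_generated fgmod;
  fgmod_proj : projective_module fgmod
}.

Definition fg_hom (M N : fgproj) : zmodType := linmap M N.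
Definition fg_id (M : fgproj) : fg_hom M M := (idfun : {linear M -> M}).
Definition fg_comp (M N P : fgproj) (g : fg_hom N P) (f : fg_hom M N) :
    fg_hom M P :=
  ((g : linmap N P) \o (f : linmap M N) : {linear M -> P}).

Fact fg_compA (X Y Z W : fgproj) (h : fg_hom Z W) (g : fg_hom Y Z)
    (f : fg_hom X Y) : fg_comp h (fg_comp g f) = fg_comp (fg_comp h g) f.
Proof. exact: linmapP. Qed.

Fact fg_comp1m (X Y : fgproj) (f : fg_hom X Y) : fg_comp (fg_id Y) f = f.
Proof. exact: linmapP. Qed.

Fact fg_compm1 (X Y : fgproj) (f : fg_hom X Y) : fg_comp f (fg_id X) = f.
Proof. exact: linmapP. Qed.

Fact fg_compDl (X Y Z : fgproj) (g g' : fg_hom Y Z) (f : fg_hom X Y) :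
  fg_comp (g + g') f = fg_comp g f + fg_comp g' f.
Proof. exact: linmapP. Qed.

Fact fg_compDr (X Y Z : fgproj) (g : fg_hom Y Z) (f f' : fg_hom X Y) :
  fg_comp g (f + f') = fg_comp g f + fg_comp g f'.
Proof. by apply: linmapP => x; rewrite /= [LHS](raddfD (g : linmap Y Z)). Qed.

Fact zero_fg : finitely_generated 'rV[R]_0.
Proof.
exists 0, (fun=> 0) => x; exists (fun=> 0).
by rewrite big_ord0; apply/rowP=> -[].
Qed.

Fact zero_proj : projective_module 'rV[R]_0.
Proof.
move=> M N p f _; exists \0 => x /=; rewrite raddf0.
have -> : x = 0 by apply/rowP=> -[].
by rewrite raddf0.
Qed.

Fact fg_zero : exists O : fgproj, forall X : fgproj,
  (forall f : fg_hom O X, f = 0) /\ (forall f : fg_hom X O, f = 0).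
Proof.
exists (FGProj zero_fg zero_proj) => X; split=> f; apply: linmapP => x.
  have -> : x = 0 by apply/rowP=> -[].
  by rewrite (raddf0 (f : linmap _ _)).
by apply/rowP=> -[].
Qed.

Fact prod_fg (M N : fgproj) : finitely_generated (M * N)%type.
Proof.
have [m [e he]] := fgmod_fg M; have [n [e' he']] := fgmod_fg N.
exists (m + n), (fun i => match split i with
  | inl j => in_left N (e j) | inr k => in_right M (e' k) end).
case=> x y; have [a ->] := he x; have [b ->] := he' y.
exists (fun i => match split i with inl j => a j | inr k => b k end).
rewrite big_split_ord /= -in_leftD_right !linear_sum.
congr (_ + _); apply: eq_bigr => i _.
  by rewrite (unsplitK (inl i)) linearZ.
by rewrite (unsplitK (inr i)) linearZ.
Qed.

Fact prod_proj (M N : fgproj) : projective_module (M * N)%type.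
Proof.
move=> A B p f hp.
have [g hg] := fgmod_proj (f \o @in_left R M N) hp.
have [h hh] := fgmod_proj (f \o @in_right R M N) hp.
exists ((g \o fst) \+ (h \o snd)) => -[x y] /=.
by rewrite raddfD /= hg hh /= -raddfD /= in_leftD_right.
Qed.

Fact fg_biproduct (X Y : fgproj) : exists B : fgproj,
  exists (i1 : fg_hom X B) (i2 : fg_hom Y B)
    (p1 : fg_hom B X) (p2 : fg_hom B Y),
  [/\ fg_comp p1 i1 = fg_id X, fg_comp p2 i2 = fg_id Y,
      fg_comp p2 i1 = 0, fg_comp p1 i2 = 0
    & fg_comp i1 p1 + fg_comp i2 p2 = fg_id B].
Proof.
exists (FGProj (@prod_fg X Y) (@prod_proj X Y)).
exists (@in_left R X Y : {linear _ -> _}), (@in_right R X Y : {linear _ -> _}).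
exists (fst : {linear (X * Y)%type -> X}), (snd : {linear (X * Y)%type -> Y}).
by split; apply: linmapP => // -[x y]; apply: in_leftD_right.
Qed.

Definition fgproj_category : additive_category :=
  AdditiveCategory fg_compA fg_comp1m fg_compm1 fg_compDl fg_compDr
    fg_zero fg_biproduct.

Fact regular_fg : finitely_generated R^o.
Proof.
exists 1, (fun=> 1) => x; exists (fun=> x).
by rewrite big_ord1; apply/esym/mulr1.
Qed.

Fact regular_proj : projective_module R^o.
Proof.
move=> M N p f /(_ (f 1))[m hm].
have lin : linear (fun x : R^o => x *: m).
  by move=> a x y; rewrite scalerDl scalerA.
pose g : {linear R^o -> M} := HB.pack (fun x : R^o => x *: m)
  (GRing.isLinear.Build R R^o M _ _ lin).
by exists g => x; rewrite /= linearZ /= hm -linearZ /= -[x *: 1]/(x * 1) mulr1.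
Qed.

Definition regular_module : fgproj := FGProj regular_fg regular_proj.
End FinitelyGeneratedProjectives.

Definition PZ4 : additive_category := fgproj_category 'Z_4.

Definition Z4 : PZ4 := regular_module 'Z_4.

Definition mul2 : hom Z4 Z4 := ( *:%R 2 : {linear ('Z_4)^o -> ('Z_4)^o}).

(* Main.v *)
(** A cone [C] of [2] on an object [X] of a stable category is the pushout of an
    injective embedding of [X] along [2]; the universal property factors [2] on
    [C] through that injective object, so [2] vanishes on [C].  A projective
    [Z/4]-module killed by [2] is zero, so if the stable category were
    equivalent to P(Z/4) by an additive functor, [C] would vanish, [2] would be
    monic on the object corresponding to [Z/4], and [4 = 0] would force [2 = 0].

    For the exactness of the triangle, complete [2] to an exact triangle with
    third object [C].  The long exact sequence of [Hom(Z/4, -)] shows that [C]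
    has order 4, and projectivity excludes [Z/2 + Z/2]: an element [c] of [C]
    mapped to [2] satisfies [2 c = g 1], so [1 |-> c] identifies the triangle
    with the one to be shown exact. *)
From HB Require Import structures.
From mathcomp Require Import all_boot all_order all_algebra.
From mathcomp Require Import boolp.
Require Import Defs.

Set Implicit Arguments.
Unset Strict Implicit.
Unset Printing Implicit Defensive.

Import GRing.Theory.
Local Open Scope ring_scope.

(** * Exactness of triangles under [Hom(W, -)] *)

Section ExactSequences.
Variables (C : additive_category) (D : triangle_class (id_functor C)).
Hypothesis HD : triangulated (Pretriangulated D).

(** [idm X] and [f] map the trivial triangle X -> X -> 0 to the given one, so [g ∘ f] factors
    through a zero object. *)
Lemma exact_tri_comp0 (X Y Z : C) (f : hom X Y) (g : hom Y Z) (h : hom Z X) :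
  D f g h -> g ∘ f = 0.
Proof.
move=> hD; have [O hO] := zero_objP C.
have hid : D (idm X) (0 : hom X O) 0 by apply: (exact_tri_id HD); apply: (hO O).1.
have [|c [hc _]] := exact_tri_fill HD (a := idm X) (b := f) hid hD.
  by rewrite !compm1.
by move: hc => /= <-; rewrite compm0.
Qed.

(** [x] starts a morphism from the rotated trivial triangle W -> 0 -> W -> W. Rotation makes its
    last map [- idm W], hence the sign in the witness. *)
Lemma exact_tri_weak_kernel (X Y Z W : C) (f : hom X Y) (g : hom Y Z)
    (h : hom Z X) (x : hom W X) :
  D f g h -> f ∘ x = 0 -> exists c : hom W Z, h ∘ c = x.
Proof.
move=> hD fx0; have [O hO] := zero_objP C.
have hid : D (idm W) (0 : hom W O) 0 by apply: (exact_tri_id HD); apply: (hO O).1.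
have hrot : D (0 : hom W O) 0 (- idm W) := (exact_tri_rot HD _ _ _).1 hid.
have [|c [_ hc]] := exact_tri_fill HD (a := x) (b := 0) hrot hD.
  by rewrite compm0 fx0.
by exists (- c); move: hc => /=; rewrite compNr compm1 compNr => <-; rewrite opprK.
Qed.

End ExactSequences.

(** * Multiplication by 2 in stable categories, and equivalences *)

Lemma two_eq0_iso (C : additive_category) (X Y : C) (u : hom X Y) (v : hom Y X) :
  v ∘ u = idm X -> idm Y + idm Y = 0 -> idm X + idm X = 0.
Proof.
by move=> <- h; rewrite -[u in LHS]comp1m -compDr -compDl h comp0m compm0.
Qed.

Section StableConeOfTwo.
Variable E : exact_category.

(** The second property is that of a weak cokernel of 2: a factorization of [g + g] through an
    injective extends along [inj_in H X], and the pushout glues the extension to [g]. *)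
Lemma stable_cone2 (H : injective_embeddings E) (X : E) :
  exists (C : E) (j : hom X C), stable_class (idm C + idm C) = 0 /\
  forall (W : E) (g : hom X W), stable_class (g + g) = 0 ->
    exists c : hom C W, c ∘ j = g.
Proof.
have [C [k [j [[kj up] _]]]] :=
  admissible_mono_pushout (idm X + idm X) (inj_mono H X).
exists C, j; split.
  have [|t [[tk tj] _]] := up _ (idm _ + idm _) (inj_in H X).
    by rewrite compDl compDr !comp1m !compm1.
  rewrite -(stable_class0 C C); apply/stable_classP; rewrite subr0.
  exists (inj_of H X), t, k; split; first exact: inj_of_injective.
  (* Both 2 on [C] and [k ∘ t] restrict to [k + k] and [j + j], so uniqueness identifies them. *)
  have [|u [_ hu]] := up _ (k + k) (j + j).
    by rewrite compDl kj !compDr !compm1.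
  rewrite -(hu (idm C + idm C)); last by rewrite !compDl !comp1m.
  by apply: hu; rewrite -!compA tk tj compDr compm1 kj compDr compm1.
move=> W g; rewrite -(stable_class0 X W) => /stable_classP; rewrite subr0.
move=> [J [a [b [hJ hg]]]].
have [a' ha'] := hJ _ _ _ a (inj_mono H X).
have [|c [[_ cj] _]] := up _ (b ∘ a') g; last by exists c.
by rewrite -compA ha' compDr compm1 hg.
Qed.

End StableConeOfTwo.

Section Equivalences.
Variables (C D : additive_category) (F : functor C D).
Hypothesis hF : equivalence F.

Lemma equivalence_faithful (X Y : C) (f g : hom X Y) :
  fmap F f = fmap F g -> f = g.
Proof.
case: hF => G [[t [ti tn]] _] e.
have [u [ut tu]] := ti X.
rewrite -[f]compm1 -[g]compm1 -tu !compA.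
have /= hf := tn _ _ f; have /= hg := tn _ _ g.
by move: hf hg => /= <- <-; rewrite e.
Qed.

Lemma equivalence_dense (Y : D) : exists (X : C) (u : hom (F X) Y), is_iso u.
Proof. by case: hF => G [_ [t [ti _]]]; exists (G Y), (t Y); exact: ti. Qed.

End Equivalences.

(** * Finitely generated projective modules, in particular over [Z/4] *)

Section ProjectiveModules.
Variable R : comNzRingType.

Lemma regular_map (M : lmodType R) (m : M) :
  exists g : {linear R^o -> M}, forall x, g x = x *: m.
Proof.
have lin : linear (fun x : R^o => x *: m).
  by move=> a x y; rewrite scalerDl scalerA.
pose g : {linear R^o -> M} := HB.pack (fun x : R^o => x *: m)
  (GRing.isLinear.Build R R^o M _ _ lin).
by exists g.
Qed.

Lemma regular_mapE (M : lmodType R) (g : {linear R^o -> M}) x :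
  g x = x *: g 1.
Proof. by rewrite -linearZ /= -[x *: 1]/(x * 1) mulr1. Qed.

(** The section [s] of [p] makes [P] a direct summand of a free module, where division by [b] is
    done coordinatewise. *)
Lemma fgproj_divisible (P : fgproj R) (a b : R) (x : P) :
  (forall r, a * r = 0 -> exists s, r = b * s) ->
  a *: x = 0 -> exists y, x = b *: y.
Proof.
move=> hab ax0; have [n [e he]] := fgmod_fg P.
have lin : linear (fun v : 'rV[R]_n => \sum_i v 0 i *: e i).
  move=> c u v; rewrite scaler_sumr -big_split /=; apply: eq_bigr => i _.
  by rewrite !mxE scalerDl scalerA.
pose p : {linear 'rV[R]_n -> P} :=
  HB.pack (fun v : 'rV[R]_n => \sum_i v 0 i *: e i)
    (GRing.isLinear.Build R _ P _ _ lin).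
have [y|s hs] := fgmod_proj (idfun : {linear P -> P}) (p := p).
  have [c ->] := he y; exists (\row_i c i).
  by apply: eq_bigr => i _; rewrite mxE.
have /fin_all_exists[v hv] i : exists v, s x 0 i = b * v.
  by apply: hab; have /rowP/(_ i) := congr1 s ax0; rewrite linearZ linear0 !mxE.
exists (p (\row_i v i)); rewrite -linearZ /= -[LHS]hs; congr (p _).
by apply/rowP=> i; rewrite hv !mxE.
Qed.

Lemma fgproj_iso (P Q : fgproj_category R) (f : hom P Q) :
  injective (f : linmap P Q) -> (forall y, exists x, (f : linmap P Q) x = y) ->
  exists g, inverse_pair f g.
Proof.
move=> finj fsurj.
have [g hg] := fgmod_proj (idfun : {linear Q -> Q}) fsurj.
by exists g; split; apply: linmapP => x /=; [apply: finj|]; rewrite hg.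
Qed.

End ProjectiveModules.

Lemma Z4_ann2 (x : 'Z_4) : 2 * x = 0 -> x = 0 \/ x = 2.
Proof.
by case: x => [[|[|[|[|]]]] //] i /(congr1 val) //= _; [left|right]; apply: val_inj.
Qed.

Lemma Z4_ann2_div (x : 'Z_4) : 2 * x = 0 -> exists y, x = 2 * y.
Proof.
by case/Z4_ann2=> ->; [exists 0|exists 1]; rewrite ?mulr0 ?mulr1.
Qed.

Lemma Z4_parity (x : 'Z_4) : exists y, x = y * 2 \/ x = y * 2 + 1.
Proof.
case: x => [[|[|[|[|]]]] //] i; [exists 0; left|exists 0; right|exists 1; left
  |exists 1; right]; exact: val_inj.
Qed.

(** Each element is killed by 2, hence is twice another element, hence is zero. *)
Lemma PZ4_two_eq0 (P : PZ4) : idm P + idm P = 0 -> idm P = 0.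
Proof.
move=> h2; have h x : (2 : 'Z_4) *: (x : fgmod P) = 0.
  by rewrite scaler_nat mulr2n; apply: (congr1 (fun f : linmap P P => f x) h2).
apply: linmapP => x /=; have [y ->] := fgproj_divisible Z4_ann2_div (h x).
exact: h.
Qed.

Lemma Z4_two_neq0 : idm Z4 + idm Z4 <> 0.
Proof.
by move/(congr1 (fun f : linmap Z4 Z4 => f 1)) => /(congr1 val).
Qed.

Lemma Z4_hom (P : PZ4) (x : fgmod P) :
  exists f : hom Z4 P, (f : linmap Z4 P) 1 = x.
Proof. by have [f hf] := regular_map x; exists f; rewrite hf scale1r. Qed.

(** * The exact triangle on 2 *)

Lemma exact_tri_mul2 (D : triangle_class (id_functor PZ4)) :
  triangulated (Pretriangulated D) -> D Z4 Z4 Z4 mul2 mul2 mul2.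
Proof.
move=> HD; have [C [g [h hD]]] := exact_tri_cone HD mul2.
have {}hD : D _ _ _ mul2 g h := hD.
have hD2 : D _ _ _ g h (- mul2) := (exact_tri_rot HD _ _ _).1 hD.
have hD3 : D _ _ _ h (- mul2) (- g) := (exact_tri_rot HD _ _ _).1 hD2.
pose g' : {linear ('Z_4)^o -> fgmod C} := g.
pose h' : {linear fgmod C -> ('Z_4)^o} := h.
have h2 x : 2 * (h' x : 'Z_4) = 0.
  have := exact_tri_comp0 HD hD3 => /(congr1 (fun f : linmap C Z4 => f x)).
  by move/eqP; rewrite [X in X == _]/= oppr_eq0 => /eqP.
have g2 : 2 *: g' 1 = 0.
  rewrite -linearZ; exact: (congr1 (fun f : linmap Z4 C => f 1) (exact_tri_comp0 HD hD)).
have g1 : g' 1 <> 0.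
  (* If [g] vanished, the identity of [Z4] would factor through [- mul2]. *)
  move=> g10; have [|c hc] := exact_tri_weak_kernel HD (x := idm Z4) hD2.
    by apply: linmapP => x; rewrite [LHS](regular_mapE g') g10 scaler0.
  have := congr1 (fun f : linmap Z4 Z4 => f 1) hc.
  rewrite /=; move: ((c : linmap Z4 Z4) 1) => z.
  by case: z => [[|[|[|[|]]]] //] i /(congr1 val).
have kerh y : h' y = 0 -> exists z : 'Z_4, y = z *: g' 1.
  move=> hy; have [f hf] := Z4_hom y.
  have [|c hc] := exact_tri_weak_kernel HD (x := f) hD3.
    apply: linmapP => x; rewrite -[LHS]/(h' ((f : linmap Z4 C) x)).
    by rewrite (regular_mapE (f : linmap Z4 C)) hf linearZ /= hy scaler0.
  by exists (- (c : linmap Z4 Z4) 1); rewrite -hf -hc scaleNr -regular_mapE.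
have [c hc] : exists c, h' c = 2.
  have [f hf] := Z4_hom (P := Z4) 2.
  have [|c hc] := exact_tri_weak_kernel HD (x := f) hD.
    apply: linmapP => x.
    rewrite -[LHS]/(2 * ((f : linmap Z4 Z4) x : 'Z_4)).
    rewrite (regular_mapE (f : linmap Z4 Z4)) hf.
    by rewrite -[RHS]/(0 : 'Z_4); case: x => [[|[|[|[|]]]] //] i; apply/eqP.
  by exists ((c : linmap Z4 C) 1); rewrite -hf -hc.
have imh y : h' y = 0 \/ h' y = 2 by apply: Z4_ann2.
have c2 : 2 *: c = g' 1.
  have [|z hz] := kerh (2 *: c); first by rewrite linearZ /= hc; apply: val_inj.
  have [z0|//] : 2 *: c = 0 \/ 2 *: c = g' 1.
    rewrite hz; have [y [->|->]] := Z4_parity z; [left|right];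
      by rewrite ?scalerDl -scalerA g2 scaler0 // add0r scale1r.
  (* If [2 *: c] were zero, [c] would be [2 *: d], and [h' c] would be [2 * h' d = 0] instead of
     2. *)
  have [d hd] := fgproj_divisible Z4_ann2_div z0.
  by move: hc; rewrite hd linearZ /= [_ *: _]h2 => /(congr1 val).
have [phi hphi] := Z4_hom c.
have phiE x : (phi : linmap Z4 C) x = x *: c.
  by rewrite (regular_mapE (phi : linmap Z4 C)) hphi.
have [||psi [psiphi phipsi]] := fgproj_iso (f := phi).
- apply: raddf_inj => x phix0; have xc0 : x *: c = 0 by rewrite -phiE.
  have : 2 * x = 0.
    have := congr1 h' xc0; rewrite linearZ linear0 hc => <-.
    by rewrite mulrC.
  by case/Z4_ann2=> // x2; case: g1; rewrite -c2 -xc0 x2.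
(* Either [y] or [y - c] lies in the kernel of [h'], which is generated by [g' 1 = 2 *: c]. *)
- move=> y; have [hy|hy] := imh y.
    by have [z hz] := kerh _ hy; exists (z * 2); rewrite phiE -scalerA c2 hz.
  have [|z hz] := kerh (y - c); first by rewrite linearB hy hc subrr.
  by exists (z * 2 + 1); rewrite phiE scalerDl -scalerA c2 -hz scale1r subrK.
have phi2 : phi ∘ mul2 = g.
  apply: linmapP => x; rewrite -[LHS]/((phi : linmap Z4 C) (2 * x)) phiE.
  by rewrite [RHS](regular_mapE g') mulrC -scalerA c2.
have hphi2 : h ∘ phi = mul2.
  apply: linmapP => x; rewrite -[LHS]/(h' ((phi : linmap Z4 C) x)) phiE.
  by rewrite linearZ hc /=; apply: mulrC.
apply: (exact_tri_iso HD (a := idm Z4) (b := idm Z4) (c := psi) hD).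
- by exists (idm Z4); split; rewrite comp1m.
- by exists (idm Z4); split; rewrite comp1m.
- by exists phi.
- by rewrite comp1m compm1.
- by rewrite -phi2 compA psiphi comp1m compm1.
by rewrite [LHS]comp1m -hphi2 -compA phipsi compm1.
Qed.

(** * Comparison of [PZ4] with stable categories *)

Lemma PZ4_not_stable (E : exact_category) (H : injective_embeddings E)
    (F : functor PZ4 (stable_additive E)) :
  additive_functor F -> ~ equivalence F.
Proof.
move=> Fadd Feq; pose X : E := F Z4.
have F0 Y Z : fmap F (0 : hom Y Z) = 0.
  by apply: (addrI (fmap F (0 : hom Y Z))); rewrite -Fadd !addr0.
have [C [j [C2 lift]]] := stable_cone2 H X.
have [P [u [v [vu uv]]]] := equivalence_dense Feq (C : stable_additive E).
have idC0 : idm (C : stable_additive E) = 0.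
  have P0 : idm P = 0.
    apply/PZ4_two_eq0/(equivalence_faithful Feq).
    rewrite F0 Fadd fmap1; apply: (two_eq0_iso vu).
    by rewrite [LHS](esym (stable_classD _ _)).
  by rewrite -uv -[u]compm1 -(fmap1 F) P0 F0 compm0 comp0m.
have F4 : stable_class (idm X + idm X + (idm X + idm X)) = 0.
  rewrite !stable_classD.
  have e : stable_class (idm X) = fmap F (idm Z4) by rewrite fmap1.
  rewrite !e; rewrite -[LHS]/(fmap F (idm Z4) + fmap F (idm Z4)
    + (fmap F (idm Z4) + fmap F (idm Z4))) -!Fadd -[RHS](F0 Z4 Z4).
  congr (fmap F _); apply: linmapP => x.
  by case: x => [[|[|[|[|]]]] //] i; apply/eqP.
(* Taking 2 on [X] for [g], the relation 4 = 0 makes 2 factor through [j], whose target [C] is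
   stably zero. *)
have [c hc] := lift _ _ F4.
apply: Z4_two_neq0; apply: (equivalence_faithful Feq).
rewrite F0 Fadd fmap1 [LHS](esym (stable_classD _ _)) -hc -stable_class_comp.
have -> : stable_class j = 0.
  rewrite -[LHS](@comp1m (stable_additive E)) idC0.
  exact: (@comp0m (stable_additive E)).
exact: (@compm0 (stable_additive E)).
Qed.

Theorem mainTheorem3 (Delta : triangle_class (id_functor PZ4))
    (HDelta : triangulated (Pretriangulated Delta)) :
  Delta Z4 Z4 Z4 mul2 mul2 mul2 /\ ~ algebraic (Pretriangulated Delta).
Proof.
split; first exact: exact_tri_mul2.
by case=> E [H [_ [F [[Fadd _]]]]]; apply: PZ4_not_stable.
Qed.
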